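(* Let $p:\widetilde{\mathcal{U}}\to\mathcal{U}$ be a natural model on a small category $\mathbb{C}$ and let $P(X)=\sum_{A:\mathcal{U}}X^A$ be the associated polynomial functor. The type-theoretic rules for (extensional) dependent products are modelled by maps $$\lambda:P(\widetilde{\mathcal{U}})\to\widetilde{\mathcal{U}},\qquad \Pi:P(\mathcal{U})\to\mathcal{U}$$ making the square $p\circ\lambda=\Pi\circ P(p)$ (with top $\lambda$, left side $P(p):P(\widetilde{\mathcal{U}})\to P(\mathcal{U})$, bottom $\Pi$, right side $p$) a pullback. That is: given such a pair $(\Pi,\lambda)$, the operations $\Pi_AB:=\Pi\circ(A,B)$ and $\lambda_Ab:=\lambda\circ(A,b)$ are the formation and introduction operations of a $\Pi$-structure on $p$; and conversely the formation and introduction operations of any $\Pi$-structure on $p$ arise in this way from a pair $(\Pi,\lambda)$ making the square a pullback.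
   Context: A *natural model* on a small category $\mathbb{C}$ is a natural transformation $p:\widetilde{\mathcal{U}}\to\mathcal{U}$ of presheaves together with, for each object $\Gamma$ and $A\in\mathcal{U}(\Gamma)$, a chosen object $\Gamma.A$, map $p_A:\Gamma.A\to\Gamma$ in $\mathbb{C}$ and $q_A\in\widetilde{\mathcal{U}}(\Gamma.A)$ such that the square $p\circ q_A=A\circ p_A$ is a pullback of presheaves (objects of $\mathbb{C}$ are identified with representables, elements at $\Gamma$ with maps out of $\Gamma$; restriction along $\sigma$ is written $x\sigma$). Elements of $\mathcal{U}(\Gamma)$ are types in context $\Gamma$; $a\in\widetilde{\mathcal{U}}(\Gamma)$ has type $p(a)$, written $a:A$ if $p(a)=A$. For $\sigma:\Delta\to\Gamma$ and $a:A\sigma$ in context $\Delta$, $(\sigma,a):\Delta\to\Gamma.A$ is the unique map with $p_A(\sigma,a)=\sigma$, $q_A(\sigma,a)=a$. Write $\sigma_A=(\sigma p_{A\sigma},q_{A\sigma}):\Delta.A\sigma\to\Gamma.A$. For $a:A$ in context $\Gamma$ and $B\in\mathcal{U}(\Gamma.A)$, $b\in\widetilde{\mathcal{U}}(\Gamma.A)$, put $B[a]=B(1,a)$, $b[a]=b(1,a)$. $P:\widehat{\mathbb{C}}\to\widehat{\mathbb{C}}$ is $P(X)=\Sigma_{\mathcal{U}}\,\Pi_p\,\widetilde{\mathcal{U}}^*X$ (pull back along $\widetilde{\mathcal{U}}\to1$, apply the right adjoint $\Pi_p$ to pullback along $p$, then compose with $\mathcal{U}\to 1$). Elements of $P(X)(\Gamma)$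 are identified with pairs $(A,x)$, $A\in\mathcal{U}(\Gamma)$, $x\in X(\Gamma.A)$. A *$\Pi$-structure* on $p$ (model of the rules for extensional dependent products) consists of operations, for all $\Gamma$, $A\in\mathcal{U}(\Gamma)$, $B\in\mathcal{U}(\Gamma.A)$: - (formation) $\Pi_AB\in\mathcal{U}(\Gamma)$; - (introduction) for $b:B$ in context $\Gamma.A$, a term $\lambda_Ab:\Pi_AB$ in context $\Gamma$; - (elimination) for $f:\Pi_AB$ and $a:A$ in context $\Gamma$, a term $f(a):B[a]$ in context $\Gamma$; satisfying ($\beta$) $(\lambda_Ab)(a)=b[a]$; ($\eta$) $\lambda_A\big((fp_A)(q_A)\big)=f$ for $f:\Pi_AB$; and stability under every $\sigma:\Delta\to\Gamma$: $(\Pi_AB)\sigma=\Pi_{A\sigma}(B\sigma_A)$, $(\lambda_Ab)\sigma=\lambda_{A\sigma}(b\sigma_A)$, $(f(a))\sigma=(f\sigma)(a\sigma)$. *)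

(* Defs.v *)
From Corelib Require Import ssreflect.
From Stdlib Require Import FunctionalExtensionality ProofIrrelevance IndefiniteDescription.

Set Implicit Arguments.
Unset Strict Implicit.
Unset Printing Implicit Defensive.
#[local] Obligation Tactic := try done.

Record Category := {
  ob :> Type;
  hom : ob -> ob -> Type;
  idm : forall X, hom X X;
  comp : forall X Y Z, hom Y Z -> hom X Y -> hom X Z;
  comp_idl : forall X Y (f : hom X Y), comp (idm Y) f = f;
  comp_idr : forall X Y (f : hom X Y), comp f (idm X) = f;
  comp_assoc : forall W X Y Z (h : hom Y Z) (g : hom X Y) (f : hom W X),
    comp h (comp g f) = comp (comp h g) f }.

Arguments hom {c} _ _.
Arguments idm {c} X.
Notation "g ∘ f" := (comp g f) (at level 40, left associativity).

(* Smallness of the base category is the universe constraint, forced by the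
   representables and by [depprod] below, that its objects and arrows live in
   the universe in which presheaves take their values. *)
Record Presheaf (C : Category) := {
  elt :> C -> Type;
  res : forall Δ Γ : C, hom Δ Γ -> elt Γ -> elt Δ;
  res_id : forall Γ (x : elt Γ), res (idm Γ) x = x;
  res_comp : forall Θ Δ Γ (σ : hom Δ Γ) (τ : hom Θ Δ) (x : elt Γ),
    res (σ ∘ τ) x = res τ (res σ x) }.

Notation "x ⋆ σ" := (res σ x) (at level 40, left associativity).

Record Map (C : Category) (X Y : Presheaf C) := {
  map_at :> forall Γ, X Γ -> Y Γ;
  map_nat : forall Δ Γ (σ : hom Δ Γ) (x : X Γ),
    map_at (x ⋆ σ) = map_at x ⋆ σ }.

Lemma map_ext (C : Category) (X Y : Presheaf C) (f g : Map X Y) :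
  (forall Γ (x : X Γ), f Γ x = g Γ x) -> f = g.
Proof.
case: f g => [f nf] [g ng] /= e.
have E : f = g.
  by apply: functional_extensionality_dep => Γ; apply: functional_extensionality.
by subst g; rewrite (proof_irrelevance _ nf ng).
Qed.

Lemma map_eq (C : Category) (X Y : Presheaf C) (f g : Map X Y) :
  f = g -> forall Γ (x : X Γ), f Γ x = g Γ x.
Proof. by move=> ->. Qed.

Program Definition mcomp (C : Category) (X Y Z : Presheaf C) (g : Map Y Z) (f : Map X Y) : Map X Z :=
  {| map_at := fun Γ x => g Γ (f Γ x) |}.
Next Obligation. by move=> * /=; rewrite !map_nat. Qed.

Notation "g ⊚ f" := (mcomp g f) (at level 40, left associativity).

(* Square with top [t], left side [l], bottom [b] and right side [r]. *)
Definition IsPullback (C : Category) (W X Y Z : Presheaf C)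
    (t : Map W Y) (l : Map W X) (b : Map X Z) (r : Map Y Z) : Prop :=
  r ⊚ t = b ⊚ l /\
  forall (V : Presheaf C) (u : Map V X) (v : Map V Y), r ⊚ v = b ⊚ u ->
    exists! w : Map V W, l ⊚ w = u /\ t ⊚ w = v.

Program Definition yo (C : Category) (Γ : C) : Presheaf C :=
  {| elt := fun Δ => hom Δ Γ; res := fun _ _ τ σ => σ ∘ τ |}.
Next Obligation. by move=> * /=; rewrite comp_idr. Qed.
Next Obligation. by move=> * /=; rewrite comp_assoc. Qed.

Program Definition yo_map (C : Category) (Δ Γ : C) (σ : hom Δ Γ) : Map (yo Δ) (yo Γ) :=
  {| map_at := fun _ τ => σ ∘ τ |}.
Next Obligation. by move=> * /=; rewrite comp_assoc. Qed.

Program Definition yo_elt (C : Category) (X : Presheaf C) (Γ : C) (x : X Γ) : Map (yo Γ) X :=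
  {| map_at := fun _ σ => x ⋆ σ |}.
Next Obligation. by move=> * /=; rewrite res_comp. Qed.

Record Over (C : Category) (X : Presheaf C) := {
  total : Presheaf C;
  over : Map total X }.

Record OverMap (C : Category) (X : Presheaf C) (Y Z : Over X) := {
  om :> Map (total Y) (total Z);
  om_over : over Z ⊚ om = over Y }.

Lemma om_at (C : Category) (X : Presheaf C) (Y Z : Over X) (m : OverMap Y Z) Γ y :
  over Z Γ (m Γ y) = over Y Γ y.
Proof. by rewrite -(om_over m). Qed.

Lemma om_ext (C : Category) (X : Presheaf C) (Y Z : Over X) (m n : OverMap Y Z) :
  (forall Γ y, m Γ y = n Γ y) -> m = n.
Proof.
case: m n => [m em] [n en] /= /map_ext E.
by subst n; rewrite (proof_irrelevance _ em en).
Qed.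

Program Definition om_comp (C : Category) (X : Presheaf C) (W Y Z : Over X)
    (n : OverMap Y Z) (m : OverMap W Y) : OverMap W Z :=
  {| om := om n ⊚ om m |}.
Next Obligation. by move=> *; apply: map_ext => Γ x /=; rewrite !om_at. Qed.

Record PbElt (A B D : Type) (f : A -> D) (g : B -> D) := {
  pb1 : A;
  pb2 : B;
  pb_eq : f pb1 = g pb2 }.

Lemma pb_ext (A B D : Type) (f : A -> D) (g : B -> D) (x y : PbElt f g) :
  pb1 x = pb1 y -> pb2 x = pb2 y -> x = y.
Proof.
case: x y => [a b e] [a' b' e'] /= Ea Eb; subst a' b'.
by rewrite (proof_irrelevance _ e e').
Qed.

Section BaseChange.
Variables (C : Category) (E B : Presheaf C) (p : Map E B).

Program Definition base_change_total (Z : Over B) : Presheaf C :=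
  {| elt := fun Γ => PbElt (p Γ) (over Z Γ);
     res := fun _ _ σ x => {| pb1 := pb1 x ⋆ σ; pb2 := pb2 x ⋆ σ |} |}.
Next Obligation. by move=> Z Δ Γ σ x /=; rewrite !map_nat (pb_eq x). Qed.
Next Obligation. by move=> *; apply: pb_ext; rewrite /= res_id. Qed.
Next Obligation. by move=> *; apply: pb_ext; rewrite /= res_comp. Qed.

Program Definition base_change (Z : Over B) : Over E :=
  {| total := base_change_total Z;
     over := {| map_at := fun _ x => pb1 x |} |}.

Program Definition base_change_map (Y Z : Over B) (m : OverMap Y Z) :
    OverMap (base_change Y) (base_change Z) :=
  {| om := {| map_at := fun Γ x => {| pb1 := pb1 x; pb2 := m Γ (pb2 x) |} |} |}.
Next Obligation. by move=> Y Z m Γ x /=; rewrite om_at (pb_eq x). Qed.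
Next Obligation. by move=> *; apply: pb_ext => //=; rewrite map_nat. Qed.
Next Obligation. by move=> *; apply: map_ext. Qed.

End BaseChange.

Section DepProd.
Variables (C : Category) (E B : Presheaf C) (p : Map E B).

Definition yo_over Γ (A : B Γ) : Over B := {| total := yo Γ; over := yo_elt A |}.

Program Definition yo_over_map Δ Γ (σ : hom Δ Γ) (A : B Γ) :
    OverMap (yo_over (A ⋆ σ)) (yo_over A) := {| om := yo_map σ |}.
Next Obligation. by move=> *; apply: map_ext => Θ τ /=; rewrite res_comp. Qed.

(* An element over [A] of a right adjoint to base change must be a map from
   the base change of [yo_over A], by the Yoneda lemma. *)
Record DepProdElt (Y : Over E) (Γ : C) := {
  dp_base : B Γ;
  dp_fun : OverMap (base_change p (yo_over dp_base)) Y }.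

Definition dp_app (Y : Over E) Γ (s : DepProdElt Y Γ) Δ (σ : hom Δ Γ) (a : E Δ)
    (h : p Δ a = dp_base s ⋆ σ) : total Y Δ :=
  dp_fun s Δ (@Build_PbElt _ _ _ (p Δ) (over (yo_over (dp_base s)) Δ) a σ h).

Lemma dp_app_over (Y : Over E) Γ (s : DepProdElt Y Γ) Δ (σ : hom Δ Γ) (a : E Δ)
    (h : p Δ a = dp_base s ⋆ σ) : over Y Δ (dp_app h) = a.
Proof. exact: om_at. Qed.

Lemma dp_app_sub (Y : Over E) Γ (s : DepProdElt Y Γ) Θ Δ (τ : hom Θ Δ) (σ : hom Δ Γ) σ'
    (a : E Δ) a' (h : p Δ a = dp_base s ⋆ σ) (h' : p Θ a' = dp_base s ⋆ σ') :
  a ⋆ τ = a' -> σ ∘ τ = σ' -> dp_app h ⋆ τ = dp_app h'.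
Proof.
by move=> Ea Eσ; rewrite /dp_app -map_nat; congr (om (dp_fun s) _ _); apply: pb_ext.
Qed.

Lemma dp_ext (Y : Over E) Γ (s t : DepProdElt Y Γ) :
  dp_base s = dp_base t ->
  (forall Δ (σ : hom Δ Γ) a h h', @dp_app Y Γ s Δ σ a h = @dp_app Y Γ t Δ σ a h') ->
  s = t.
Proof.
case: s t => [A s] [A' t] /= e; subst A'; rewrite /dp_app /= => H.
by have -> : s = t by apply: om_ext => Δ [a σ h]; apply: H.
Qed.

Program Definition depprod_total (Y : Over E) : Presheaf C :=
  {| elt := DepProdElt Y;
     res := fun _ _ σ s =>
       {| dp_base := dp_base s ⋆ σ;
          dp_fun := om_comp (dp_fun s) (base_change_map p (yo_over_map σ (dp_base s))) |} |}.
Next Obligation.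
move=> Y Γ s; apply: dp_ext => /= [|Δ σ a h h']; first by rewrite res_id.
by rewrite /dp_app /=; congr (dp_fun s _ _); apply: pb_ext => //=; rewrite comp_idl.
Qed.
Next Obligation.
move=> Y Θ Δ Γ σ τ s; apply: dp_ext => /= [|Ξ ρ a h h']; first by rewrite res_comp.
by rewrite /dp_app /=; congr (dp_fun s _ _); apply: pb_ext => //=; rewrite comp_assoc.
Qed.

Program Definition depprod (Y : Over E) : Over B :=
  {| total := depprod_total Y;
     over := {| map_at := fun _ s => dp_base s |} |}.

Program Definition depprod_map (Y Z : Over E) (m : OverMap Y Z) :
    OverMap (depprod Y) (depprod Z) :=
  {| om := {| map_at := fun Γ s =>
       ({| dp_base := dp_base s; dp_fun := om_comp m (dp_fun s) |} : depprod_total Z Γ) |} |}.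
Next Obligation.
move=> Y Z m Δ Γ σ s; apply: dp_ext => //= Θ τ a h h'.
by rewrite /dp_app /=; congr (om m _ (dp_fun _ _ _)); apply: pb_ext.
Qed.
Next Obligation. by move=> *; apply: map_ext. Qed.

Lemma dp_base_id (Y : Over E) Γ (x : total (base_change p (depprod Y)) Γ) :
  p Γ (pb1 x) = dp_base (pb2 x) ⋆ idm Γ.
Proof. by rewrite res_id (pb_eq x). Qed.

Program Definition depprod_counit (Y : Over E) :
    OverMap (base_change p (depprod Y)) Y :=
  {| om := {| map_at := fun Γ x => dp_app (dp_base_id x) |} |}.
Next Obligation.
move=> Y Δ Γ σ x; rewrite /dp_app -map_nat /=; congr (dp_fun (pb2 x) _ _).
by apply: pb_ext => //=; rewrite comp_idl comp_idr.
Qed.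
Next Obligation. by move=> Y; apply: map_ext => Γ x; apply: (eq_trans (om_at _ _)). Qed.

Lemma depprod_counit_nat (Y Z : Over E) (m : OverMap Y Z) :
  om_comp (depprod_counit Z) (base_change_map p (depprod_map m)) =
  om_comp m (depprod_counit Y).
Proof.
apply: om_ext => Γ x; rewrite /= /dp_app /=.
by congr (om m _ (dp_fun _ _ _)); apply: pb_ext.
Qed.

Lemma depprod_adjoint (Y : Over E) (Z : Over B) (g : OverMap (base_change p Z) Y) :
  exists! h : OverMap Z (depprod Y),
    om_comp (depprod_counit Y) (base_change_map p h) = g.
Proof.
have ez Γ (z : total Z Γ) Δ (x : total (base_change p (yo_over (over Z Γ z))) Δ) :
    p Δ (pb1 x) = over Z Δ (z ⋆ pb2 x).
  by rewrite (pb_eq x) /= map_nat.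
pose s0 Γ (z : total Z Γ) Δ (x : total (base_change p (yo_over (over Z Γ z))) Δ) :
    total Y Δ := g Δ (Build_PbElt (ez Γ z Δ x)).
have s0_nat Γ z : forall Δ' Δ (τ : hom Δ' Δ) x, s0 Γ z Δ' (x ⋆ τ) = s0 Γ z Δ x ⋆ τ.
  move=> Δ' Δ τ x; rewrite /s0 -map_nat; congr (om g _ _); apply: pb_ext => //=.
  by rewrite res_comp.
pose s1 Γ z := Build_Map (s0_nat Γ z).
have s1_over Γ z : over Y ⊚ s1 Γ z = over (base_change p (yo_over (over Z Γ z))).
  by apply: map_ext => Δ x; rewrite /= /s0 om_at.
pose k0 Γ z : depprod_total Y Γ :=
  {| dp_base := over Z Γ z; dp_fun := Build_OverMap (s1_over Γ z) |}.
have k0_nat : forall Δ Γ (σ : hom Δ Γ) z, k0 Δ (z ⋆ σ) = k0 Γ z ⋆ σ.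
  move=> Δ Γ σ z; apply: dp_ext => /= [|Θ τ a h h']; first by rewrite map_nat.
  rewrite /dp_app /= /s0; congr (om g _ _); apply: pb_ext => //=.
  by rewrite res_comp.
have k_over : over (depprod Y) ⊚ Build_Map k0_nat = over Z by apply: map_ext.
exists (Build_OverMap k_over); split.
  apply: om_ext => Γ x; rewrite /= /dp_app /= /s0; congr (om g _ _).
  by apply: pb_ext => //=; rewrite res_id.
move=> h Eg; apply: om_ext => Γ z; apply: dp_ext => /= [|Δ σ a e e'].
  by rewrite -(om_at h).
have H (t : depprod_total Y Δ) (e1 : p Δ a = dp_base t ⋆ idm Δ) :
    t = h Γ z ⋆ σ -> dp_app e1 = dp_app e'.
  move=> Et; subst t; rewrite /dp_app /=; congr (dp_fun _ _ _).
  by apply: pb_ext => //=; rewrite comp_idr.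
rewrite {1}/dp_app /= /s0 -Eg /=; apply: H; exact: map_nat.
Qed.

End DepProd.

Program Definition terminal (C : Category) : Presheaf C := {| elt := fun _ => unit; res := fun _ _ _ x => x |}.

Program Definition bang (C : Category) (X : Presheaf C) : Map X (terminal C) :=
  {| map_at := fun _ _ => tt |}.

Definition over_terminal (C : Category) (X : Presheaf C) : Over (terminal C) :=
  {| total := X; over := bang X |}.

Program Definition over_terminal_map (C : Category) (X Y : Presheaf C) (f : Map X Y) :
    OverMap (over_terminal X) (over_terminal Y) := {| om := f |}.
Next Obligation. by move=> *; apply: map_ext. Qed.

Section Polynomial.
Variables (C : Category) (E B : Presheaf C) (p : Map E B).

(* Σ_B Π_p E^*X: pull [X] back along E -> 1, apply [depprod p], and forget the
   map to [B]. *)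
Definition poly (X : Presheaf C) : Presheaf C :=
  total (depprod p (base_change (bang E) (over_terminal X))).

Definition poly_map (X Y : Presheaf C) (f : Map X Y) : Map (poly X) (poly Y) :=
  depprod_map p (base_change_map (bang E) (over_terminal_map f)).

End Polynomial.

Record NaturalModel (C : Category) := {
  U : Presheaf C;
  Ut : Presheaf C;
  typ : Map Ut U;
  ext : forall Γ : C, U Γ -> C;
  proj : forall Γ (A : U Γ), hom (ext A) Γ;
  var : forall Γ (A : U Γ), Ut (ext A);
  ext_pullback : forall Γ (A : U Γ),
    IsPullback (yo_elt (var A)) (yo_map (proj A)) (yo_elt A) typ }.

Arguments U {C} n.
Arguments Ut {C} n.
Arguments typ {C} n.
Arguments ext {C n Γ} A.
Arguments proj {C n Γ} A.
Arguments var {C n Γ} A.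
Arguments ext_pullback {C n Γ} A.

Section Model.
Variables (C : Category) (N : NaturalModel C).

Record Tm (Γ : C) (A : U N Γ) := {
  tm :> Ut N Γ;
  tm_typ : typ N Γ tm = A }.

Definition tm_cast Γ (A A' : U N Γ) (e : A = A') (a : Tm A) : Tm A' :=
  {| tm := a; tm_typ := eq_trans (tm_typ a) e |}.

Program Definition tm_sub Γ (A : U N Γ) (a : Tm A) Δ (σ : hom Δ Γ) : Tm (A ⋆ σ) :=
  {| tm := tm a ⋆ σ |}.
Next Obligation. by move=> * /=; rewrite map_nat tm_typ. Qed.

Program Definition vart Γ (A : U N Γ) : Tm (A ⋆ proj A) := {| tm := var A |}.
Next Obligation.
move=> Γ A; have [e _] := ext_pullback A.
have := map_eq e (idm (ext A)).
by rewrite /= res_id comp_idr.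
Qed.

Lemma pair_ex Δ Γ (σ : hom Δ Γ) (A : U N Γ) (a : Tm (A ⋆ σ)) :
  exists τ : hom Δ (ext A), proj A ∘ τ = σ /\ var A ⋆ τ = a.
Proof.
have [_ up] := ext_pullback A.
have [|w [[w1 w2] _]] := up (yo Δ) (yo_map σ) (yo_elt (tm a)).
  by apply: map_ext => Θ τ /=; rewrite map_nat tm_typ res_comp.
exists (w Δ (idm Δ)); split.
  by have := map_eq w1 (idm Δ); rewrite /= comp_idr.
by have := map_eq w2 (idm Δ); rewrite /= res_id.
Qed.

Definition pair Δ Γ (σ : hom Δ Γ) (A : U N Γ) (a : Tm (A ⋆ σ)) : hom Δ (ext A) :=
  proj1_sig (constructive_indefinite_description _ (pair_ex a)).

Lemma proj_pair Δ Γ (σ : hom Δ Γ) (A : U N Γ) (a : Tm (A ⋆ σ)) : proj A ∘ pair a = σ.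
Proof. by rewrite /pair; case: constructive_indefinite_description => ? []. Qed.

Lemma var_pair Δ Γ (σ : hom Δ Γ) (A : U N Γ) (a : Tm (A ⋆ σ)) : var A ⋆ pair a = a.
Proof. by rewrite /pair; case: constructive_indefinite_description => ? []. Qed.

Lemma hom_ext_eq Δ Γ (A : U N Γ) (τ τ' : hom Δ (ext A)) :
  proj A ∘ τ = proj A ∘ τ' -> var A ⋆ τ = var A ⋆ τ' -> τ = τ'.
Proof.
move=> ep ev; have [sq up] := ext_pullback A.
have [|w [_ wu]] := up (yo Δ) (yo_map (proj A ∘ τ)) (yo_elt (var A ⋆ τ)).
  apply: map_ext => Θ ρ; have := map_eq sq (τ ∘ ρ).
  by rewrite /= res_comp comp_assoc.
have key ρ : proj A ∘ ρ = proj A ∘ τ -> var A ⋆ ρ = var A ⋆ τ -> w = yo_map ρ.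
  move=> e1 e2; apply: wu; split; apply: map_ext => Θ κ /=.
    by rewrite comp_assoc e1.
  by rewrite res_comp e2.
have := eq_trans (eq_sym (key τ eq_refl eq_refl)) (key τ' (eq_sym ep) (eq_sym ev)).
by move/map_eq/(_ Δ (idm Δ)); rewrite /= !comp_idr.
Qed.

(* [lift σ A] is σ_A : Δ.Aσ -> Γ.A *)
Definition lift Δ Γ (σ : hom Δ Γ) (A : U N Γ) : hom (ext (A ⋆ σ)) (ext A) :=
  pair (tm_cast (eq_sym (res_comp σ (proj (A ⋆ σ)) A)) (vart (A ⋆ σ))).

(* [inst a] is (1, a) : Γ -> Γ.A *)
Definition inst Γ (A : U N Γ) (a : Tm A) : hom Γ (ext A) :=
  pair (tm_cast (eq_sym (res_id A)) a).

Lemma lift_vart (X : Presheaf C) Γ (A : U N Γ) (x : X (ext A)) :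
  (x ⋆ lift (proj A) A) ⋆ inst (vart A) = x.
Proof.
rewrite -res_comp -[RHS]res_id; congr (_ ⋆ _); apply: hom_ext_eq.
  by rewrite comp_assoc proj_pair -comp_assoc proj_pair !comp_idr.
by rewrite res_comp var_pair /= var_pair /= res_id.
Qed.

(* [tm_cast] only changes the type annotation of a term, so all equations
   between terms are stated in the presheaf [Ut N]. *)
Record PiStructure := {
  pi_form : forall Γ (A : U N Γ), U N (ext A) -> U N Γ;
  pi_lam : forall Γ (A : U N Γ) (B : U N (ext A)), Tm B -> Tm (pi_form B);
  pi_app : forall Γ (A : U N Γ) (B : U N (ext A)),
    Tm (pi_form B) -> forall a : Tm A, Tm (B ⋆ inst a);
  pi_form_sub : forall Δ Γ (σ : hom Δ Γ) (A : U N Γ) (B : U N (ext A)),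
    pi_form B ⋆ σ = pi_form (B ⋆ lift σ A);
  pi_lam_sub : forall Δ Γ (σ : hom Δ Γ) (A : U N Γ) (B : U N (ext A)) (b : Tm B),
    tm (pi_lam b) ⋆ σ = pi_lam (tm_sub b (lift σ A));
  pi_app_sub : forall Δ Γ (σ : hom Δ Γ) (A : U N Γ) (B : U N (ext A))
      (f : Tm (pi_form B)) (a : Tm A),
    tm (pi_app f a) ⋆ σ = pi_app (tm_cast (pi_form_sub σ B) (tm_sub f σ)) (tm_sub a σ);
  pi_beta : forall Γ (A : U N Γ) (B : U N (ext A)) (b : Tm B) (a : Tm A),
    tm (pi_app (pi_lam b) a) = tm b ⋆ inst a;
  pi_eta : forall Γ (A : U N Γ) (B : U N (ext A)) (f : Tm (pi_form B)),
    tm (pi_lam (tm_cast (lift_vart B)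
      (pi_app (tm_cast (pi_form_sub (proj A) B) (tm_sub f (proj A))) (vart A)))) = f }.

Lemma poly_pair_typ Γ (A : U N Γ) Δ
    (z : total (base_change (typ N) (yo_over A)) Δ) : typ N Δ (pb1 z) = A ⋆ pb2 z.
Proof. exact: pb_eq z. Qed.

(* The element (A, x) of P(X)(Γ), as the map (a, σ) ↦ (a, x(σ, a)) over [Ut N];
   by [poly_pair_bij] every element of P(X)(Γ) is uniquely of this form. *)
Program Definition poly_pair (X : Presheaf C) Γ (A : U N Γ) (x : X (ext A)) :
    poly (typ N) X Γ :=
  {| dp_base := A;
     dp_fun := {| om := {| map_at := fun Δ z =>
       {| pb1 := pb1 z;
          pb2 := x ⋆ pair {| tm := pb1 z; tm_typ := poly_pair_typ z |} |} |} |} |}.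
Next Obligation.
move=> X Γ A x Θ Δ σ z; apply: pb_ext => //=; rewrite -res_comp; congr (_ ⋆ _).
apply: hom_ext_eq; first by rewrite comp_assoc !proj_pair.
by rewrite [RHS]res_comp !var_pair.
Qed.
Next Obligation. by move=> *; apply: map_ext. Qed.

Lemma poly_pair_bij (X : Presheaf C) Γ (s : poly (typ N) X Γ) :
  exists! Ax : {A : U N Γ & X (ext A)}, poly_pair (projT2 Ax) = s.
Proof.
pose unpair (t : poly (typ N) X Γ) : {A : U N Γ & X (ext A)} :=
  existT _ (dp_base t) (pb2 (@dp_app _ _ _ (typ N) _ Γ t _ _ _ (tm_typ (vart (dp_base t))))).
exists (unpair s); split=> [|[A x] <-].
  apply: dp_ext => //= Δ σ a h h'; rewrite {1}/dp_app /=; apply: pb_ext => /=.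
    exact: (eq_sym (dp_app_over h')).
  set v := dp_app _; apply: (f_equal (@pb2 _ _ _ _ _) (_ : v ⋆ _ = _)).
  by apply: dp_app_sub; rewrite ?var_pair ?proj_pair.
rewrite /unpair /=; congr existT.
rewrite -[RHS]res_id; congr (_ ⋆ _); apply: hom_ext_eq; first by rewrite proj_pair comp_idr.
by rewrite var_pair res_id.
Qed.

Lemma poly_pair_sub (X : Presheaf C) Δ Γ (σ : hom Δ Γ) (A : U N Γ) (x : X (ext A)) :
  poly_pair x ⋆ σ = poly_pair (x ⋆ lift σ A).
Proof.
apply: dp_ext => //= Θ τ a h h'; rewrite /dp_app /=; apply: pb_ext => //=.
rewrite -res_comp; congr (_ ⋆ _); apply: hom_ext_eq.
  by rewrite comp_assoc !proj_pair -comp_assoc proj_pair.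
by rewrite [RHS]res_comp !var_pair /= ?var_pair.
Qed.

Lemma poly_map_pair (X Y : Presheaf C) (f : Map X Y) Γ (A : U N Γ) (x : X (ext A)) :
  poly_map (typ N) f Γ (poly_pair x) = poly_pair (f _ x).
Proof.
apply: dp_ext => //= Δ τ a h h'; rewrite /dp_app /=; apply: pb_ext => //=.
rewrite map_nat; congr (_ ⋆ _); apply: hom_ext_eq; first by rewrite !proj_pair.
by rewrite !var_pair.
Qed.

Definition induces (Pi : Map (poly (typ N) (U N)) (U N))
    (lam : Map (poly (typ N) (Ut N)) (Ut N)) (S : PiStructure) : Prop :=
  (forall Γ (A : U N Γ) (B : U N (ext A)), pi_form S B = Pi Γ (poly_pair B)) /\
  (forall Γ (A : U N Γ) (B : U N (ext A)) (b : Tm B),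
    tm (pi_lam S b) = lam Γ (poly_pair (tm b))).

End Model.

(* Main.v *)
From Corelib Require Import ssreflect.
From Stdlib Require Import ProofIrrelevance IndefiniteDescription.
Require Import Defs.

(** By the Yoneda lemma the square is a pullback iff it is one at every stage.
    At stage [Γ] an element of [P(U)] is a pair [(A, B)], an element of [P(Ut)]
    is a pair [(A, b)], and [P(typ)] sends [(A, b)] to [(A, typ b)].  So the
    fibre of [P(Ut)] over [(A, B)] is the set of terms [b : B], the fibre of
    [Ut] over [Π(A, B)] is the set of terms [f : Π_A B], and the square is a
    pullback iff it commutes and [b ↦ λ_A b] is a bijection between these two sets for all
    [A] and [B] ([pullback_iff_lam_bijective]).

    Such a bijection is the same thing as application with β and η.  If every
    [f : Π_A B] has a unique body [b] with [λ_A b = f], put [f(a) = b[a]]: β is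
    uniqueness of the body, η is its existence, and application is stable under
    substitution because bodies, being unique, are.  Conversely, in a
    Π-structure the body of [f] is [(f p_A)(q_A)]: it is mapped to [f] by η, and
    β shows that it is [b] when [f = λ_A b].

    Passing between operations on pairs and maps out of [P(X)] is
    [poly_map_of_family]: a map out of [P(X)] is a family of operations on the
    [X(Γ.A)] that is stable under substitution. *)

Set Implicit Arguments.
Unset Strict Implicit.
Unset Printing Implicit Defensive.

(** * Pullbacks of presheaves are computed stage by stage *)

Section Pointwise.
Variables (C : Category) (W X Y Z : Presheaf C).
Variables (t : Map W Y) (l : Map W X) (b : Map X Z) (r : Map Y Z).

(** Test the universal property on representables: by Yoneda, maps out of
    [yo Γ] are elements at [Γ]. *)
Lemma pullback_at : IsPullback t l b r ->
  forall Γ (x : X Γ) (y : Y Γ), r Γ y = b Γ x ->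
    exists! w : W Γ, l Γ w = x /\ t Γ w = y.
Proof.
move=> [_ up] Γ x y e.
have [|h [[hl ht] hu]] := up (yo Γ) (yo_elt x) (yo_elt y).
  by apply: map_ext => Δ σ /=; rewrite !map_nat e.
exists (h Γ (idm Γ)); split.
  have := map_eq hl (idm Γ); have := map_eq ht (idm Γ).
  by rewrite /= !res_id.
move=> w [wx wy].
have -> : h = yo_elt w.
  by apply: hu; split; apply: map_ext => Δ σ /=; rewrite map_nat ?wx ?wy.
by rewrite /= res_id.
Qed.

(** The mediating map is chosen stage by stage; uniqueness at each stage makes
    the choice natural. *)
Lemma pullback_of_at : r ⊚ t = b ⊚ l ->
  (forall Γ (x : X Γ) (y : Y Γ), r Γ y = b Γ x ->
    exists! w : W Γ, l Γ w = x /\ t Γ w = y) ->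
  IsPullback t l b r.
Proof.
move=> sq pw; split=> // V u v e.
have ex Γ z : exists w : W Γ, l Γ w = u Γ z /\ t Γ w = v Γ z.
  by have [w [hw _]] := pw _ _ _ (map_eq e z); exists w.
have un Γ z w w' : l Γ w = u Γ z /\ t Γ w = v Γ z ->
    l Γ w' = u Γ z /\ t Γ w' = v Γ z -> w = w'.
  by have [w0 [_ hu]] := pw _ _ _ (map_eq e z) => /hu <- /hu <-.
pose h0 Γ z := proj1_sig (constructive_indefinite_description _ (ex Γ z)).
have h0P Γ z : l Γ (h0 Γ z) = u Γ z /\ t Γ (h0 Γ z) = v Γ z.
  by rewrite /h0; case: constructive_indefinite_description.
have h0_nat Δ Γ (σ : hom Δ Γ) z : h0 Δ (z ⋆ σ) = h0 Γ z ⋆ σ.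
  by apply: un (h0P _ _) _; have [el et] := h0P Γ z; rewrite !map_nat el et.
exists (Build_Map h0_nat); split.
  by split; apply: map_ext => Γ z; have [] := h0P Γ z.
move=> h [hl ht]; apply: map_ext => Γ z; apply: un (h0P _ _) _.
exact: (conj (map_eq hl z) (map_eq ht z)).
Qed.

End Pointwise.

Section NaturalModel.
Variables (C : Category) (N : NaturalModel C).

(** * Elements of the polynomial functor as pairs *)

Lemma poly_pair_surj (X : Presheaf C) Γ (s : poly (typ N) X Γ) :
  exists (A : U N Γ) (x : X (ext A)), s = poly_pair x.
Proof. by have [[A x] [<- _]] := poly_pair_bij s; exists A, x. Qed.

Lemma poly_pair_inj (X : Presheaf C) Γ (A A' : U N Γ) (x : X (ext A)) (x' : X (ext A')) :
  poly_pair x = poly_pair x' ->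
  existT (fun A : U N Γ => X (ext A)) A x = existT _ A' x'.
Proof.
move=> e; have [v [_ hu]] := poly_pair_bij (poly_pair x').
by rewrite -(hu (existT _ A x) e) -(hu (existT _ A' x') eq_refl).
Qed.

Lemma poly_pair_injr (X : Presheaf C) Γ (A : U N Γ) (x x' : X (ext A)) :
  poly_pair x = poly_pair x' -> x = x'.
Proof. by move=> e; apply: (inj_pair2 _ _ _ _ _ (poly_pair_inj e)). Qed.

(** [P(typ)] sends [(A', b)] to [(A', typ b)], and pairs are equal only if their
    components are. *)
Lemma poly_map_typ_fibre Γ (A : U N Γ) (B : U N (ext A)) (w : poly (typ N) (Ut N) Γ) :
  poly_map (typ N) (typ N) Γ w = poly_pair B -> exists b : Tm B, w = poly_pair (tm b).
Proof.
have [A' [b ->]] := poly_pair_surj w.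
rewrite poly_map_pair => /poly_pair_inj e.
(* [B] depends on [A], so the conclusion is stated over the pair (A, B), which
   [e] can rewrite as a whole. *)
suff : exists b' : Tm (projT2 (existT (fun A : U N Γ => U N (ext A)) A B)),
    poly_pair b = poly_pair (tm b') by [].
by rewrite -e; exists {| tm := b; tm_typ := eq_refl |}.
Qed.

(** Every element of [P(X)] is uniquely a pair, so the family determines the
    values of the map; stability under substitution is its naturality. *)
Lemma poly_map_of_family (X Y : Presheaf C)
    (φ : forall Γ (A : U N Γ), X (ext A) -> Y Γ) :
  (forall Δ Γ (σ : hom Δ Γ) (A : U N Γ) (x : X (ext A)),
    φ Γ A x ⋆ σ = φ Δ (A ⋆ σ) (x ⋆ lift σ A)) ->
  exists F : Map (poly (typ N) X) Y,
    forall Γ (A : U N Γ) (x : X (ext A)), F Γ (poly_pair x) = φ Γ A x.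
Proof.
move=> φ_sub.
have ex Γ (s : poly (typ N) X Γ) :
    exists Ax : {A : U N Γ & X (ext A)}, poly_pair (projT2 Ax) = s.
  by have [Ax [e _]] := poly_pair_bij s; exists Ax.
pose F0 Γ s :=
  let Ax := proj1_sig (constructive_indefinite_description _ (ex Γ s)) in
  φ Γ (projT1 Ax) (projT2 Ax).
have F0_pair Γ (A : U N Γ) (x : X (ext A)) : F0 Γ (poly_pair x) = φ Γ A x.
  rewrite /F0; case: constructive_indefinite_description => [[A' x']] /= /poly_pair_inj e.
  exact: (f_equal (fun Ax => φ Γ (projT1 Ax) (projT2 Ax)) e).
have F0_nat Δ Γ (σ : hom Δ Γ) s : F0 Δ (s ⋆ σ) = F0 Γ s ⋆ σ.
  have [A [x ->]] := poly_pair_surj s.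
  by rewrite poly_pair_sub !F0_pair φ_sub.
by exists (Build_Map F0_nat).
Qed.

(** * Terms and substitutions *)

Lemma tm_ext Γ (A : U N Γ) (a a' : Tm A) : tm a = tm a' -> a = a'.
Proof.
case: a a' => [a e] [a' e'] /= E; subst a'.
by rewrite (proof_irrelevance _ e e').
Qed.

Lemma inst_sub Δ Γ (σ : hom Δ Γ) (A : U N Γ) (a : Tm A) :
  inst a ∘ σ = lift σ A ∘ inst (tm_sub a σ).
Proof.
apply: hom_ext_eq.
  by rewrite !comp_assoc !proj_pair -comp_assoc proj_pair comp_idl comp_idr.
by rewrite !res_comp !var_pair /= ?var_pair.
Qed.

(** * The square is a pullback iff abstraction is bijective *)

Section Square.
Variables (Pi : Map (poly (typ N) (U N)) (U N)) (lam : Map (poly (typ N) (Ut N)) (Ut N)).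
Hypothesis square : typ N ⊚ lam = Pi ⊚ poly_map (typ N) (typ N).

(** Compare fibres at stage [Γ]: that of [P(Ut)] over a pair [(A, B)] consists
    of the terms of [B] by [poly_map_typ_fibre] and [poly_pair_injr], that of
    [Ut] over the image of the pair consists of the terms [f]. *)
Lemma pullback_iff_lam_bijective :
  IsPullback lam (poly_map (typ N) (typ N)) Pi (typ N) <->
  forall Γ (A : U N Γ) (B : U N (ext A)) (f : Tm (Pi Γ (poly_pair B))),
    exists! b : Tm B, lam Γ (poly_pair (tm b)) = f.
Proof.
split=> [pb Γ A B f | bij].
  have [w [[wl wt] wu]] := pullback_at pb (tm_typ f).
  have [b e] := poly_map_typ_fibre wl; exists b; split; first by rewrite -e.
  move=> b' e'; apply: tm_ext; apply: poly_pair_injr.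
  by rewrite -e; apply: wu; rewrite poly_map_pair tm_typ.
apply: pullback_of_at => // Γ s f.
have [A [B ->]] := poly_pair_surj s => ef.
have [b [eb bu]] := bij _ _ _ {| tm := f; tm_typ := ef |}.
exists (poly_pair (tm b)); split; first by rewrite poly_map_pair tm_typ.
by move=> w [/poly_map_typ_fibre [b' ->]] /bu ->.
Qed.

Lemma lam_typ Γ (A : U N Γ) (B : U N (ext A)) (b : Tm B) :
  typ N Γ (lam Γ (poly_pair (tm b))) = Pi Γ (poly_pair B).
Proof.
apply: (eq_trans (map_eq square (poly_pair (tm b)))).
change (Pi Γ (poly_map (typ N) (typ N) Γ (poly_pair (tm b))) = Pi Γ (poly_pair B)).
by rewrite poly_map_pair tm_typ.
Qed.

(** * From a pullback square to a Π-structure *)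

Hypothesis lam_bij : forall Γ (A : U N Γ) (B : U N (ext A)) (f : Tm (Pi Γ (poly_pair B))),
  exists! b : Tm B, lam Γ (poly_pair (tm b)) = f.

Lemma lam_inj Γ (A : U N Γ) (B : U N (ext A)) (b b' : Tm B) :
  lam Γ (poly_pair (tm b)) = lam Γ (poly_pair (tm b')) -> b = b'.
Proof.
move=> e; have [b0 [_ hu]] := lam_bij {| tm := _; tm_typ := lam_typ b' |}.
by rewrite -(hu b e) -(hu b' eq_refl).
Qed.

Lemma lam_surj Γ (A : U N Γ) (B : U N (ext A)) (f : Tm (Pi Γ (poly_pair B))) :
  exists b : Tm B, lam Γ (poly_pair (tm b)) = f.
Proof. by have [b [e _]] := lam_bij f; exists b. Qed.

Definition body Γ (A : U N Γ) (B : U N (ext A)) (f : Tm (Pi Γ (poly_pair B))) : Tm B :=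
  proj1_sig (constructive_indefinite_description _ (lam_surj f)).

Lemma lam_body Γ (A : U N Γ) (B : U N (ext A)) (f : Tm (Pi Γ (poly_pair B))) :
  lam Γ (poly_pair (tm (body f))) = f.
Proof. by rewrite /body; case: constructive_indefinite_description. Qed.

Lemma Pi_sub Δ Γ (σ : hom Δ Γ) (A : U N Γ) (B : U N (ext A)) :
  Pi Γ (poly_pair B) ⋆ σ = Pi Δ (poly_pair (B ⋆ lift σ A)).
Proof. by rewrite -map_nat poly_pair_sub. Qed.

(** Both sides are bodies of [f σ]: naturality of [lam] says so of the right
    one. *)
Lemma body_sub Δ Γ (σ : hom Δ Γ) (A : U N Γ) (B : U N (ext A))
    (f : Tm (Pi Γ (poly_pair B))) :
  body (tm_cast (Pi_sub σ B) (tm_sub f σ)) = tm_sub (body f) (lift σ A).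
Proof.
by apply: lam_inj; rewrite lam_body /= -poly_pair_sub map_nat lam_body.
Qed.

(** Application is substitution into the body.  In η, the body of [f p_A]
    applied to the variable is the body of [f] weakened along [lift (proj A) A]
    and then instantiated at [q_A], which is the body of [f] again. *)
Lemma pi_structure_of_lam_bijective : exists S : PiStructure N, induces Pi lam S.
Proof.
unshelve refine (ex_intro _ (@Build_PiStructure C N
  (fun Γ A B => Pi Γ (poly_pair B))
  (fun Γ A B b => {| tm := lam Γ (poly_pair (tm b)); tm_typ := lam_typ b |})
  (fun Γ A B f a => tm_sub (body f) (inst a))
  Pi_sub _ _ _ _) _).
- by move=> Δ Γ σ A B b /=; rewrite -map_nat poly_pair_sub.
- by move=> Δ Γ σ A B f a /=; rewrite body_sub /= -!res_comp inst_sub.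
- move=> Γ A B b a /=; congr (tm _ ⋆ _).
  by apply: lam_inj; rewrite lam_body.
- by move=> Γ A B f /=; rewrite body_sub /= lift_vart lam_body.
- by split.
Qed.

End Square.

(** * From a Π-structure to a pullback square *)

Section OfStructure.
Variable S : PiStructure N.

(** The type of a term is determined by its underlying element, so abstraction
    is well defined on elements of [Ut N]; this is what makes it a map out of
    [P(Ut)], whose elements carry no separate type annotation. *)
Lemma pi_lam_tm Γ (A : U N Γ) (B B' : U N (ext A)) (b : Tm B) (b' : Tm B') :
  tm b = tm b' -> tm (pi_lam S b) = tm (pi_lam S b').
Proof.
move=> e; have eB : B = B' by rewrite -(tm_typ b) -(tm_typ b') e.
by subst B'; rewrite (tm_ext e).
Qed.

(** The inverse of [pi_lam S]: the body [(f p_A)(q_A)] that η speaks of. *)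
Definition pi_body Γ (A : U N Γ) (B : U N (ext A)) (f : Tm (pi_form S B)) : Tm B :=
  tm_cast (lift_vart B)
    (pi_app (tm_cast (pi_form_sub S (proj A) B) (tm_sub f (proj A))) (vart A)).

Lemma pi_body_lam Γ (A : U N Γ) (B : U N (ext A)) (b : Tm B) :
  pi_body (pi_lam S b) = b.
Proof.
apply: tm_ext; rewrite /pi_body /=.
have -> : tm_cast (pi_form_sub S (proj A) B) (tm_sub (pi_lam S b) (proj A)) =
    pi_lam S (tm_sub b (lift (proj A) A)).
  by apply: tm_ext; rewrite /= pi_lam_sub.
by rewrite pi_beta /= lift_vart.
Qed.

Lemma pullback_of_pi_structure :
  exists (Pi : Map (poly (typ N) (U N)) (U N)) (lam : Map (poly (typ N) (Ut N)) (Ut N)),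
    IsPullback lam (poly_map (typ N) (typ N)) Pi (typ N) /\ induces Pi lam S.
Proof.
have [Pi PiE] := @poly_map_of_family (U N) (U N) (fun Γ A B => pi_form S B)
  (pi_form_sub S).
pose self_typed Γ (A : U N Γ) (b : Ut N (ext A)) : Tm (typ N _ b) :=
  {| tm := b; tm_typ := eq_refl |}.
have [|lam lamE'] := @poly_map_of_family (Ut N) (Ut N)
  (fun Γ A b => tm (pi_lam S (self_typed Γ A b))).
  by move=> Δ Γ σ A b; rewrite pi_lam_sub; apply: pi_lam_tm.
have lamE Γ (A : U N Γ) (B : U N (ext A)) (b : Tm B) :
    lam Γ (poly_pair (tm b)) = pi_lam S b.
  by rewrite lamE'; apply: pi_lam_tm.
exists Pi, lam; split; last by split=> *; rewrite ?PiE ?lamE.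
apply/pullback_iff_lam_bijective.
  apply: map_ext => Γ w; have [A [b ->]] := poly_pair_surj w.
  change (typ N Γ (lam Γ (poly_pair b)) =
    Pi Γ (poly_map (typ N) (typ N) Γ (poly_pair b))).
  by rewrite poly_map_pair PiE lamE' tm_typ.
move=> Γ A B; rewrite PiE => f; exists (pi_body f); split.
  by rewrite lamE; apply: pi_eta.
by move=> b; rewrite lamE => /tm_ext <-; rewrite pi_body_lam.
Qed.

End OfStructure.

End NaturalModel.

Theorem proposition8 (C : Category) (N : NaturalModel C) :
  (forall (Pi : Map (poly (typ N) (U N)) (U N))
          (lam : Map (poly (typ N) (Ut N)) (Ut N)),
     IsPullback lam (poly_map (typ N) (typ N)) Pi (typ N) ->
     exists S : PiStructure N, induces Pi lam S) /\
  (forall S : PiStructure N,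
     exists (Pi : Map (poly (typ N) (U N)) (U N))
            (lam : Map (poly (typ N) (Ut N)) (Ut N)),
       IsPullback lam (poly_map (typ N) (typ N)) Pi (typ N) /\ induces Pi lam S).
Proof.
split=> [Pi lam pb | S]; last exact: pullback_of_pi_structure.
have [square _] := pb.
apply: (pi_structure_of_lam_bijective square).
exact: (proj1 (pullback_iff_lam_bijective square) pb).
Qed.
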